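(* For each $r\in(0,1]$ there exists a decreasing sequence $\{t_n\}_{n=1}^\infty$ converging to zero with $\{t_n\}_{n=1}^\infty\in\ell^{r,\infty}(\mathbb{N})$ such that the maximal estimate $$\Bigl\|\sup_{n\in\mathbb{N}}|e^{it_n\square}f|\Bigr\|_{L^2(B(0,1))}\le C\|f\|_{H^s(\mathbb{R}^2)}$$ (with a constant $C$ independent of $f$) holds for all $f\in H^s(\mathbb{R}^2)$ only if $s\ge\frac{r}{r+1}$.
   Context: Here the dimension is $N=2$. For $t\in\mathbb{R}$, $e^{it\square}f(x)=\int_{\mathbb{R}^2}e^{ix\cdot\xi+it\xi_1\xi_2}\hat f(\xi)\,d\xi$, with $\hat f$ the Fourier transform of $f$ (normalized so that $t=0$ gives $f$; for $f\in L^2$ the integral is understood as the usual $L^2$ extension). $B(0,1)$ is the unit ball of $\mathbb{R}^2$ centered at the origin. $H^s(\mathbb{R}^2)$ is the usual inhomogeneous $L^2$-based Sobolev space. For $0<r<\infty$, a sequence $\{t_n\}$ belongs to $\ell^{r,\infty}(\mathbb{N})$ if $\sup_{b>0}b^r\,\sharp\{n\in\mathbb{N}:t_n>b\}<\infty$, where $\sharp$ denotes cardinality. *)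

(* Defs.v *)
From HB Require Import structures.
From mathcomp Require Import all_boot all_order all_algebra.
From mathcomp Require Import all_classical all_reals all_analysis.
From mathcomp Require Export complex.

Set Implicit Arguments.
Unset Strict Implicit.
Unset Printing Implicit Defensive.

Import Order.TTheory GRing.Theory Num.Theory.
Import numFieldNormedType.Exports.

Local Open Scope classical_set_scope.
Local Open Scope ring_scope.

(* R^2 is the type R * R with the Borel sigma-algebra; functions R^2 -> C are
   functions into R[i], whose modulus is Normc.normc : R[i] -> R. Every
   Lebesgue class of functions has a Borel representative, and all the notions
   below depend only on classes modulo null sets. *)

Notation mu2 R := ((@lebesgue_measure R) \x (@lebesgue_measure R))%E.

Definition cintegral (R : realType) (f : R * R -> R[i]) : R[i] :=
  Complex (Rintegral (mu2 R) setT (fun x => complex.Re (f x)))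
          (Rintegral (mu2 R) setT (fun x => complex.Im (f x))).

Definition cmeasurable (R : realType) (f : R * R -> R[i]) : Prop :=
  measurable_fun setT (fun x => complex.Re (f x)) /\
  measurable_fun setT (fun x => complex.Im (f x)).

Definition cLnorm (R : realType) (p : R) (f : R * R -> R[i]) : \bar R :=
  ('N[mu2 R]_p%:E [(fun x => (Normc.normc (f x))%:E)])%E.

Definition cLp (R : realType) (p : R) (f : R * R -> R[i]) : Prop :=
  cmeasurable f /\ (cLnorm p f < +oo)%E.

Definition cvgL2 (R : realType) (F : nat -> R * R -> R[i])
    (f : R * R -> R[i]) : Prop :=
  (fun k => cLnorm 2 (fun x => F k x - f x)) @ \oo --> (0 : \bar R)%E.

Definition dot (R : realType) (x y : R * R) : R := x.1 * y.1 + x.2 * y.2.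

(* e^{i theta} *)
Definition cis (R : realType) (theta : R) : R[i] :=
  Complex (cos theta) (sin theta).

(* The factor (2 pi)^-2 sits in the direct transform, so that the inverse
   transform, and the propagator, carry no constant. *)
Definition fourier (R : realType) (f : R * R -> R[i]) (xi : R * R) : R[i] :=
  Complex ((2 * pi) ^- 2) 0 * cintegral (fun x => cis (- dot x xi) * f x).

Definition inverse_fourier (R : realType) (g : R * R -> R[i]) (x : R * R) :
    R[i] :=
  cintegral (fun xi => cis (dot x xi) * g xi).

(* [L2_extension T f g]: g is (a version of) the image of f under the
   continuous extension to L^2 of the operator T, initially given by an
   absolutely convergent integral on the dense subspace L^1 /\ L^2. *)
Definition L2_extension (R : realType)
    (T : (R * R -> R[i]) -> (R * R -> R[i])) (f g : R * R -> R[i]) : Prop :=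
  [/\ cLp 2 f, cLp 2 g &
    exists F : nat -> R * R -> R[i],
      [/\ forall k, cLp 1 (F k) /\ cLp 2 (F k),
          cvgL2 F f &
          cvgL2 (fun k => T (F k)) g]].

(* [propagator t f u]: u is (a version of) e^{it[]}f, for f in L^2. *)
Definition propagator (R : realType) (t : R) (f u : R * R -> R[i]) : Prop :=
  exists fhat : R * R -> R[i],
    L2_extension (@fourier R) f fhat /\
    L2_extension (@inverse_fourier R)
      (fun xi => cis (t * (xi.1 * xi.2)) * fhat xi) u.

(* The H^s norm of a function, in terms of its Fourier transform. *)
Definition sobolev_norm (R : realType) (s : R) (fhat : R * R -> R[i]) :
    \bar R :=
  ('N[mu2 R]_2%:E
    [(fun xi => ((1 + dot xi xi) `^ (s / 2) * Normc.normc (fhat xi))%:E)])%E.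

(* f belongs to H^s and fhat is (a version of) its Fourier transform. For
   s < 0 this is only the dense subspace of the f in H^s that belong to L^2;
   for s >= 0 it is all of H^s. *)
Definition sobolev (R : realType) (s : R) (f fhat : R * R -> R[i]) : Prop :=
  L2_extension (@fourier R) f fhat /\ (sobolev_norm s fhat < +oo)%E.

Definition unit_ball (R : realType) : set (R * R) := [set x | dot x x < 1].

Definition maximal_function (R : realType) (u : nat -> R * R -> R[i])
    (x : R * R) : \bar R :=
  ereal_sup (range (fun n => (Normc.normc (u n x))%:E)).

Definition maximal_estimate (R : realType) (t : nat -> R) (s : R) : Prop :=
  exists C : R, forall (f fhat : R * R -> R[i]) (u : nat -> R * R -> R[i]),
    sobolev s f fhat ->
    (forall n, propagator (t n) f (u n)) ->
    ('N[mu2 R]_2%:E [maximal_function u \_ (@unit_ball R)]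
      <= C%:E * sobolev_norm s fhat)%E.

(* The space ell^{r, oo}(N). *)
Definition weak_ell (R : realType) (r : R) (t : nat -> R) : Prop :=
  (ereal_sup [set (b `^ r)%:E * counting [set n | (b < t n)%R]
             | b in [set b : R | (0 < b)%R]] < +oo)%E.

(* Main.v *)
Require Import Defs.
From mathcomp Require Import all_boot all_order all_algebra.
From mathcomp Require Import all_classical all_reals all_analysis.
From mathcomp Require Import finmap measurable_realfun ring lra.
Import Order.TTheory GRing.Theory Num.Theory.
Import numFieldNormedType.Exports.
Local Open Scope classical_set_scope.
Local Open Scope ring_scope.

Set Implicit Arguments.
Unset Strict Implicit.
Unset Printing Implicit Defensive.

(* The times are t_n = (n+1)^(-1/r). The datum is the Gaussian wave packet whose
   Fourier transform has width 1 in xi1 around N and width N in xi2 around 0.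
   For xi1 near N the symbol xi1 xi2 acts as N xi2, so the flow transports the
   packet, of size 1 x 1/N and height of order N, at speed N in the direction
   -e2, without appreciable dispersion as long as t N = O(1). The t_n below
   N^(-2/(1+r)) have gaps O(N^-2), so the packet sweeps a rectangle of size
   1 x N^(1-2/(1+r)), where the maximal function is of order N. The H^s norm is
   O(N^(s+1/2)), and letting N tend to infinity gives s >= r/(r+1).

   Since the quadratic form xi1 xi2 has a real null direction, the evolution of
   a Gaussian is computed by two successive real Gaussian Fourier transforms,
   the first of which turns the dispersive phase into a real quadratic weight.
   All functions involved are explicit and lie in L^1 and L^2, so that constant
   approximating sequences suffice in the L^2 extensions. *)

(** * Gaussian integrals *)

Definition gauss (R : realType) (a m x : R) : R := expR (- (a * (x - m) ^+ 2)).

Section gaussian_line.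
Context {R : realType}.
Implicit Types a b c m x y : R.
Local Notation mu := (@lebesgue_measure R).

Lemma gauss_ge0 a m x : 0 <= gauss a m x.
Proof. exact: expR_ge0. Qed.

Lemma measurable_gauss a m : measurable_fun setT (gauss a m).
Proof.
apply: measurableT_comp => //; apply: measurableT_comp => //.
apply: measurable_funM => //; apply: measurable_funX => //.
exact: measurable_funB.
Qed.

(** Reduces total mass and integrability to those of the normal law of variance 1 / (2 a). *)
Lemma gauss_normal_pdf a m x : 0 < a ->
  gauss a m x = Num.sqrt (pi / a) * normal_pdf m (Num.sqrt (2 * a)^-1) x.
Proof.
move=> a0; have a20 : 0 < (2 * a)^-1 by rewrite invr_gt0 mulr_gt0.
have s2 : Num.sqrt (2 * a)^-1 ^+ 2 = (2 * a)^-1 by rewrite sqr_sqrtr// ltW.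
rewrite normal_pdfE ?gt_eqF ?sqrtr_gt0// /normal_peak /normal_fun s2 mulrA.
have -> : (2 * a)^-1 * pi *+ 2 = pi / a :> R.
  by rewrite -mulr_natr; field; rewrite gt_eqF.
rewrite divff ?gt_eqF ?sqrtr_gt0 ?divr_gt0 ?pi_gt0// mul1r; congr expR.
by rewrite -mulr_natr; field; rewrite gt_eqF.
Qed.

Lemma integral_gauss a m : 0 < a ->
  (\int[mu]_x (gauss a m x)%:E)%E = (Num.sqrt (pi / a))%:E.
Proof.
move=> a0; under eq_integral do rewrite gauss_normal_pdf// EFinM.
rewrite integralZl//; last exact: integrable_normal_pdf.
by rewrite integral_normal_pdf mule1.
Qed.

Lemma integrable_gauss a m : 0 < a -> mu.-integrable setT (EFin \o gauss a m).
Proof.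
move=> a0; apply/integrableP; split.
  by apply/measurable_EFinP; exact: measurable_gauss.
under eq_integral do rewrite /= ger0_norm ?gauss_ge0//.
by rewrite integral_gauss// ltry.
Qed.

Lemma is_derive_gauss a m x :
  is_derive x 1 (gauss a m) (- (2 * a * (x - m)) * gauss a m x).
Proof.
have H : is_derive x 1 (fun y : R => - (a * (y - m) ^+ 2)) (- (2 * a * (x - m))).
  apply: is_derive_eq; rewrite /GRing.scale/=; ring.
rewrite /gauss mulrC.
exact: (is_derive1_comp (f := expR)).
Qed.

(** Half of the exponent is spent on the linear factor, through 1 + u <= exp u. The bound is an
    integrable majorant, independent of the frequency, for differentiating Gaussian integrals under
    the integral sign. *)
Lemma abs_mul_gauss_le a m x : 0 < a ->
  `|(x - m) * gauss a m x| <= (1 + a^-1) * gauss (a / 2) m x.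
Proof.
move=> a0; rewrite normrM (ger0_norm (gauss_ge0 _ _ _)).
have -> : gauss a m x = gauss (a / 2) m x * gauss (a / 2) m x.
  by rewrite /gauss -expRD; congr expR; field.
rewrite mulrA ler_wpM2r ?gauss_ge0//.
rewrite -ler_pdivlMr ?expR_gt0// /gauss -expRN opprK.
set y := x - m.
(* Expanded, the right side contains 1 + y^2 / 2, which dominates |y|; the a^-1 in the constant
   produces the y^2 / 2. *)
have h : `|y| <= (1 + a^-1) * (1 + a / 2 * y ^+ 2).
  rewrite -(real_normK (num_real y)); have := normr_ge0 y; move: `|y| => z z0.
  have -> : (1 + a^-1) * (1 + a / 2 * z ^+ 2) =
    1 + a^-1 + a / 2 * z ^+ 2 + z ^+ 2 / 2 by field; rewrite gt_eqF.
  have : 0 <= a^-1 by rewrite invr_ge0 ltW.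
  have : 0 <= a / 2 * z ^+ 2 by rewrite mulr_ge0 ?sqr_ge0 ?divr_ge0 ?ltW.
  by nra.
apply: (le_trans h); rewrite ler_wpM2l ?expR_ge1Dx//.
by rewrite addr_ge0// invr_ge0 ltW.
Qed.

(** The fundamental theorem of calculus on [-n, n], then dominated convergence with majorant |f|.
    This is the form in which integration by parts is used. *)
Lemma integral_derivative_eq0 (f F : R -> R) :
  (forall x, is_derive x 1 F (f x)) -> continuous f ->
  mu.-integrable setT (EFin \o f) ->
  F n%:R @[n --> \oo] --> 0 -> F (- n%:R) @[n --> \oo] --> 0 ->
  (\int[mu]_x (f x)%:E = 0)%E.
Proof.
move=> dF cf intf Fy FNy.
pose D (n : nat) : set R := `[- n%:R, n%:R]%classic.
pose fn n := (EFin \o f) \_ (D n).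
have mf : measurable_fun setT (EFin \o f) := measurable_int _ intf.
have [|||||_ _ +] := @dominated_convergence _ _ _ mu setT measurableT fn
  (EFin \o f) (abse \o (EFin \o f)).
- by move=> n; apply/(measurable_restrictT _ _).1 => //; first exact: measurable_itv;
  apply: (measurable_funS measurableT).
- exact: mf.
- apply: aeW => x _ /=; apply: cvg_near_cst.
  near=> n; rewrite /fn patchE ifT//; apply: mem_set; rewrite /D /= in_itv /= -ler_norml.
  near: n; exact: nbhs_infty_ger.
- exact: integrable_abse.
- apply: aeW => x n _ /=; rewrite /fn patchE.
  by case: ifP => _ /=; rewrite ?normr0 lee_fin.
have -> : [sequence (\int[mu]_x fn n x)%E]_n =
    (fun n => (F n%:R - F (- n%:R))%:E).
  apply/funext => -[|n]; rewrite /fn /= -integral_mkcond /D.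
    (* For n = 0 the interval is a point, a case apart from the fundamental theorem. *)
    by rewrite oppr0 subrr set_itv1 integral_set1.
  rewrite (@continuous_FTC2 _ f F).
  - by rewrite EFinB.
  - by rewrite -subr_gt0 opprK addr_gt0.
  - exact: continuous_subspaceT.
  - have dcF x : {for x, continuous F}.
      by apply/differentiable_continuous/derivable1_diffP; case: (dF x).
    split=> [x _||].
    + by case: (dF x).
    + exact/cvg_at_right_filter/dcF.
    + exact/cvg_at_left_filter/dcF.
  - by move=> x _; rewrite derive1E; case: (dF x).
move=> h.
have h0 : (F n%:R - F (- n%:R))%:E @[n --> \oo] --> 0%E.
  by apply: cvg_EFin; [exact: nearW|rewrite -(subr0 0); exact: cvgB].
by apply: (cvg_unique _ h h0).
Unshelve. all: end_near. Qed.

Lemma cvg_gauss a m : 0 < a -> gauss a m n%:R @[n --> \oo] --> 0.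
Proof.
move=> a0.
have -> : (fun n : nat => gauss a m n%:R) =
    gauss_fun \o (fun n : nat => (n%:R - m) * Num.sqrt a).
  apply/funext => n /=; rewrite /gauss /gauss_fun exprMn sqr_sqrtr ?ltW//.
  by rewrite mulrC.
have ny : (n%:R - m) * Num.sqrt a @[n --> \oo] --> +oo.
  apply: (@gt0_cvgMly R ((fun n : nat => n%:R - m) @ \oo) _ _ id); first by rewrite sqrtr_gt0.
  exact: (cvg_comp _ _ cvgr_idn (cvg_addrr (- m))).
exact: (cvg_comp _ _ ny cvg_gauss_fun).
Qed.

(** * Fourier transform of a Gaussian on the line *)

Let cvg_gauss_mul (u v : R ^nat) :
  u n @[n --> \oo] --> 0 -> u n * sin (v n) @[n --> \oo] --> 0.
Proof.
move=> u0; apply: norm_cvg0.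
have nu : `|u n| @[n --> \oo] --> 0 by rewrite -(normr0 R); exact: cvg_norm.
apply: (squeeze_cvgr _ (cvg_cst 0) nu); apply: nearW => n.
by rewrite normr_ge0 normrM ler_piMr// ler_norml sin_geN1 sin_le1.
Qed.

(** The phase is centred at [m], so that differentiation in [b] brings down the factor x - m
    controlled by [abs_mul_gauss_le]. *)
Let f a m c b x := gauss a m x * cos (b * (x - m) + c).
Let h a m c b x := (x - m) * gauss a m x * sin (b * (x - m) + c).

Let continuous_gauss a m : continuous (gauss a m).
Proof.
by move=> x; apply/differentiable_continuous/derivable1_diffP; case: (is_derive_gauss a m x).
Qed.

Let continuous_affine b m c : continuous (fun x : R => b * (x - m) + c).
Proof.
move=> x; apply: cvgD; last exact: cvg_cst.
by apply: cvgM; [|apply: cvgB]; by [exact: cvg_cst|exact: cvg_id].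
Qed.

Let continuous_f a m c b : continuous (f a m c b).
Proof.
move=> x; apply: cvgM; first exact: continuous_gauss.
apply: (@continuous_comp _ _ _ (fun x => b * (x - m) + c) cos).
  exact: continuous_affine.
exact: continuous_cos.
Qed.

Let continuous_h a m c b : continuous (h a m c b).
Proof.
move=> x; apply: cvgM; first (apply: cvgM; last exact: continuous_gauss).
  by apply: cvgB; [exact: cvg_id|exact: cvg_cst].
apply: (@continuous_comp _ _ _ (fun x => b * (x - m) + c) sin).
  exact: continuous_affine.
exact: continuous_sin.
Qed.

Let integrable_f a m c b : 0 < a -> mu.-integrable setT (EFin \o f a m c b).
Proof.
move=> a0; apply: le_integrable (integrable_gauss m a0) => //.
  by apply/measurable_EFinP; apply: continuous_measurable_fun.
move=> x _; rewrite lee_fin /f normrM ler_piMr// ler_norml.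
by rewrite cos_geN1 cos_le1.
Qed.

Let h_le a m c b x : 0 < a ->
  `|h a m c b x| <= (1 + a^-1) * gauss (a / 2) m x.
Proof.
move=> a0; apply: le_trans (abs_mul_gauss_le m x a0).
by rewrite normrM ler_piMr// ler_norml sin_geN1 sin_le1.
Qed.

Let integrable_bound a m : 0 < a ->
  mu.-integrable setT (EFin \o (fun x => (1 + a^-1) * gauss (a / 2) m x)).
Proof.
move=> a0; have a20 : 0 < a / 2 by rewrite divr_gt0.
rewrite /comp; under eq_fun do rewrite EFinM.
by apply: integrableZl => //; exact: integrable_gauss.
Qed.

Let integrable_h a m c b : 0 < a -> mu.-integrable setT (EFin \o h a m c b).
Proof.
move=> a0; apply: le_integrable (integrable_bound m a0) => //.
  by apply/measurable_EFinP; apply: continuous_measurable_fun.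
move=> x _; rewrite lee_fin; apply: (le_trans (h_le _ _ _ _ a0)).
exact: ler_norm.
Qed.

Let F a m c b := Rintegral mu setT (f a m c b).
Let S a m c b := Rintegral mu setT (h a m c b).

(* With F the cosine integral and S = [S a m c], the derivative F' = - S and the
   integration by parts S = b / (2 a) F make F(b) exp(b^2 / (4 a)) constant. *)
Let is_derive_F a m c b : 0 < a -> is_derive b 1 (F a m c) (- S a m c b).
Proof.
move=> a0.
have df x y : is_derive x 1 (f a m c ^~ y) (- h a m c x y).
  have H : is_derive x 1 (fun z : R => z * (y - m) + c) (y - m).
    apply: is_derive_eq; rewrite /GRing.scale/=; ring.
  have H2 : is_derive x 1 (fun z : R => cos (z * (y - m) + c))
      (- sin (x * (y - m) + c) * (y - m)).
    exact: (is_derive1_comp (f := cos)).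
  apply: is_derive_eq; rewrite /GRing.scale/= /h; ring.
have d1f x y : partial1of2 (f a m c) x y = - h a m c x y.
  by rewrite partial1of2E; case: (df x y).
have Ib : `](b - 1), (b + 1)[%classic b by rewrite /= in_itv/=; lra.
have bnd x y : `](b - 1), (b + 1)[%classic x -> setT y ->
    `|partial1of2 (f a m c) x y| <= (1 + a^-1) * gauss (a / 2) m y.
  by move=> _ _; rewrite d1f normrN h_le.
have G0 y : 0 <= (1 + a^-1) * gauss (a / 2) m y.
  by rewrite mulr_ge0 ?gauss_ge0// addr_ge0// invr_ge0 ltW.
have If x (_ : `](b - 1), (b + 1)[%classic x) := integrable_f m c x a0.
have dfb x y (_ : `](b - 1), (b + 1)[%classic x) (_ : setT y) :
  derivable (f a m c ^~ y) x 1 by case: (df x y).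
apply: DeriveDef.
  exact: (derivable_under_integral measurableT Ib If dfb G0 (integrable_bound m a0) bnd).
rewrite -derive1E.
rewrite (differentiation_under_integral measurableT Ib If dfb G0 (integrable_bound m a0) bnd).
rewrite /S -mulN1r -RintegralZl//; last exact: integrable_h.
by apply: eq_Rintegral => y _; rewrite /= d1f mulN1r.
Qed.

Let S_F a m c b : 0 < a -> S a m c b = b / (2 * a) * F a m c b.
Proof.
move=> a0; pose k x := b * f a m c b x - 2 * a * h a m c b x.
have Ik : (\int[mu]_x (k x)%:E = 0)%E.
  (* [k] is the derivative of the Gaussian times the sine, which vanishes at both infinities. *)
  apply: (@integral_derivative_eq0 k (fun x => gauss a m x * sin (b * (x - m) + c))).
  - move=> x; have := is_derive_gauss a m x => H0.
    have H : is_derive x 1 (fun z : R => b * (z - m) + c) b.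
      apply: is_derive_eq; rewrite /GRing.scale/=; ring.
    have H2 : is_derive x 1 (fun z : R => sin (b * (z - m) + c))
      (cos (b * (x - m) + c) * b) by exact: (is_derive1_comp (f := sin)).
    apply: is_derive_eq; rewrite /GRing.scale/= /k /f /h; ring.
  - move=> x; apply: cvgB; apply: cvgM; try exact: cvg_cst.
      exact: continuous_f.
    exact: continuous_h.
  - rewrite /k /comp; under eq_fun do rewrite EFinB !EFinM.
    by apply: integrableB => //; apply: integrableZl => //;
      [exact: integrable_f|exact: integrable_h].
  - exact: (cvg_gauss_mul (fun n => b * (n%:R - m) + c) (cvg_gauss m a0)).
  - apply: (cvg_gauss_mul (fun n => b * (- n%:R - m) + c)).
    have -> : (fun n : nat => gauss a m (- n%:R)) = (fun n => gauss a (- m) n%:R).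
      by apply/funext => n; rewrite /gauss opprK -opprD sqrrN.
    exact: cvg_gauss.
have : Rintegral mu setT k = b * F a m c b - 2 * a * S a m c b.
  rewrite /k RintegralB//.
  - by rewrite !RintegralZl//; [exact: integrable_h|exact: integrable_f].
  - rewrite /comp; under eq_fun do rewrite EFinM.
    by apply: integrableZl => //; exact: integrable_f.
  - rewrite /comp; under eq_fun do rewrite EFinM.
    by apply: integrableZl => //; exact: integrable_h.
rewrite /Rintegral Ik /= => /esym/eqP; rewrite subr_eq0 => /eqP bF.
have a2 : 2 * a != 0 by rewrite gt_eqF// mulr_gt0.
by apply: (mulfI a2); rewrite -bF; field; rewrite gt_eqF.
Qed.

Lemma integrable_gauss_cos a m b c : 0 < a ->
  mu.-integrable setT (EFin \o (fun x => gauss a m x * cos (b * x + c))).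
Proof.
move=> a0; have := integrable_f m (b * m + c) b a0.
by congr (mu.-integrable _ _); apply/funext => x /=; rewrite /f; congr (_ * cos _)%:E; ring.
Qed.

(** [Q] is constant in the frequency because F' = - b / (2 a) F, and at frequency 0 it is the total
    mass times a cosine. The free phase [c] makes the sine integral a special case. *)
Lemma integral_gauss_cos a m b c : 0 < a ->
  (\int[mu]_x (gauss a m x * cos (b * x + c))%:E)%E =
  (Num.sqrt (pi / a) * expR (- (b ^+ 2 / (4 * a))) * cos (b * m + c))%:E.
Proof.
move=> a0.
pose Q x := F a m (b * m + c) x * expR (x ^+ 2 / (4 * a)).
have dQ (x : R) : is_derive x 1 Q 0.
  have H0 := is_derive_F m (b * m + c) x a0.
  have H : is_derive x 1 (fun x : R => x ^+ 2 / (4 * a)) (x / (2 * a)).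
    apply: is_derive_eq; rewrite /GRing.scale/=; field.
    by rewrite gt_eqF.
  have H2 : is_derive x 1 (fun z : R => expR (z ^+ 2 / (4 * a)))
      (expR (x ^+ 2 / (4 * a)) * (x / (2 * a))) by exact: (is_derive1_comp (f := expR)).
  apply: is_derive_eq; rewrite S_F// /GRing.scale/=; ring.
have : Q b = Q 0 by exact: is_derive_0_is_cst.
rewrite /Q expr0n/= mul0r expR0 mulr1 => QE.
have F0 : F a m (b * m + c) 0 = Num.sqrt (pi / a) * cos (b * m + c).
  rewrite /F /f; under eq_Rintegral do rewrite mul0r add0r.
  rewrite RintegralZr//; last exact: integrable_gauss.
  by rewrite /Rintegral integral_gauss.
rewrite -[LHS]fineK; last first.
  by apply: integrable_fin_num => //; exact: integrable_gauss_cos.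
congr EFin; transitivity (F a m (b * m + c) b).
  by apply: eq_Rintegral => x _; rewrite /f; congr (_ * cos _); ring.
by rewrite expRN mulrAC -F0 -QE mulfK// gt_eqF// expR_gt0.
Qed.
End gaussian_line.

(** * Gaussian integrals in the plane with a phase containing the product of the variables *)

Section gaussian_plane.
Context {R : realType}.
Implicit Types a b c m t : R.
Local Notation mu := (@lebesgue_measure R).

Definition gauss2 a1 m1 a2 m2 (z : R * R) : R := gauss a1 m1 z.1 * gauss a2 m2 z.2.

Lemma gauss2_ge0 a1 m1 a2 m2 z : 0 <= gauss2 a1 m1 a2 m2 z.
Proof. by rewrite mulr_ge0 ?gauss_ge0. Qed.

Lemma measurable_gauss2 a1 m1 a2 m2 :
  measurable_fun setT (gauss2 a1 m1 a2 m2).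
Proof.
by apply: measurable_funM; apply: measurableT_comp => //; exact: measurable_gauss.
Qed.

Lemma integral_gauss2 a1 m1 a2 m2 : 0 < a1 -> 0 < a2 ->
  (\int[mu2 R]_z (gauss2 a1 m1 a2 m2 z)%:E)%E =
  (Num.sqrt (pi / a1) * Num.sqrt (pi / a2))%:E.
Proof.
move=> a10 a20; rewrite fubini_tonelli1.
- rewrite /fubini_F.
  under eq_integral do
    (under eq_integral do rewrite /gauss2/= EFinM;
     rewrite integralZl//; last exact: integrable_gauss).
  under eq_integral do rewrite integral_gauss//.
  rewrite integralZr//; last exact: integrable_gauss.
  by rewrite integral_gauss.
- by apply/measurable_EFinP; exact: measurable_gauss2.
- by move=> z; rewrite lee_fin gauss2_ge0.
Qed.

Lemma integrable_gauss2 a1 m1 a2 m2 : 0 < a1 -> 0 < a2 ->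
  (mu2 R).-integrable setT (EFin \o gauss2 a1 m1 a2 m2).
Proof.
move=> a10 a20; apply/integrableP; split.
  by apply/measurable_EFinP; exact: measurable_gauss2.
under eq_integral do rewrite /= ger0_norm ?gauss2_ge0//.
by rewrite integral_gauss2// ltry.
Qed.

Lemma measurable_phase b1 b2 t c : measurable_fun setT
  (fun z : R * R => b1 * z.1 + b2 * z.2 + t * (z.1 * z.2) + c).
Proof.
apply: measurable_funD => //; apply: measurable_funD.
  by apply: measurable_funD; apply: measurable_funM.
by apply: measurable_funM => //; apply: measurable_funM.
Qed.

Lemma integrable_gauss2_cos a1 m1 a2 m2 b1 b2 t c : 0 < a1 -> 0 < a2 ->
  (mu2 R).-integrable setT (EFin \o (fun z => gauss2 a1 m1 a2 m2 z *
    cos (b1 * z.1 + b2 * z.2 + t * (z.1 * z.2) + c))).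
Proof.
move=> a10 a20.
apply: le_integrable (integrable_gauss2 m1 m2 a10 a20) => //.
  apply/measurable_EFinP; apply: measurable_funM; first exact: measurable_gauss2.
  apply: measurableT_comp; last exact: measurable_phase.
  by apply: continuous_measurable_fun; exact: continuous_cos.
move=> z _; rewrite lee_fin normrM ler_piMr// ler_norml.
by rewrite cos_geN1 cos_le1.
Qed.

(** For fixed y the phase is linear in x, and integrating in x leaves the real weight exp (- (b1 + t
    y)^2 / (4 a1)). The remaining y-integral is again a Gaussian against a cosine of a linear
    phase. *)
Lemma integral_gauss2_cos a1 m1 a2 b1 b2 t c : 0 < a1 -> 0 < a2 ->
  let A := a2 + t ^+ 2 / (4 * a1) in
  Rintegral (mu2 R) setT (fun z => gauss2 a1 m1 a2 0 z *
    cos (b1 * z.1 + b2 * z.2 + t * (z.1 * z.2) + c)) =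
  Num.sqrt (pi / a1) * Num.sqrt (pi / A) *
  gauss2 (a2 / (4 * a1 * A)) 0 (4 * A)^-1 (- (t * m1)) (b1, b2) *
  cos (b1 * m1 - (t * m1 + b2) * (b1 * t / (4 * a1 * A)) + c).
Proof.
move=> a10 a20 A.
have A0 : 0 < A by rewrite ltr_wpDr// divr_ge0 ?sqr_ge0// mulr_ge0// ltW.
have intf := integrable_gauss2_cos m1 0 b1 b2 t c a10 a20.
set f := fun z => _ * cos _ in intf *.
rewrite /Rintegral -(@integral21_prod_meas1 _ _ _ _ _ _ _ _ intf) /fubini_G.
(* Completing the square: a2 y^2 + (b1 + t y)^2 / (4 a1) = A (y - M)^2 + a2 b1^2 / (4 a1 A). *)
pose M := - (b1 * t / (4 * a1 * A)).
have inner y : (\int[mu]_x (f (x, y))%:E)%E =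
  (Num.sqrt (pi / a1) * gauss (a2 / (4 * a1 * A)) 0 b1 *
   (gauss A M y * cos ((t * m1 + b2) * y + (b1 * m1 + c))))%:E.
  transitivity (\int[mu]_x ((gauss a2 0 y)%:E *
     (gauss a1 m1 x * cos ((b1 + t * y) * x + (b2 * y + c)))%:E))%E.
    apply: eq_integral => x _; rewrite -EFinM /f /gauss2 /=; congr EFin.
    rewrite [RHS]mulrA; congr (_ * cos _); first exact: mulrC.
    by ring.
  rewrite integralZl//.
    rewrite integral_gauss_cos// -EFinM; congr EFin.
    have -> : (b1 + t * y) * m1 + (b2 * y + c) = (t * m1 + b2) * y + (b1 * m1 + c).
      by ring.
    rewrite !mulrA; congr (_ * cos _).
    rewrite [X in X * _]mulrC -!mulrA; congr (_ * _).
    rewrite /gauss -!expRD; congr expR.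
    rewrite /M /A; field; rewrite gt_eqF//=.
    by rewrite gt_eqF// ltr_wpDr ?sqr_ge0// !mulr_gt0.
  exact: integrable_gauss_cos.
under eq_integral do rewrite inner EFinM.
rewrite integralZl//; last exact: integrable_gauss_cos.
rewrite integral_gauss_cos// -EFinM /=.
have -> : (t * m1 + b2) * M + (b1 * m1 + c) =
    b1 * m1 - (t * m1 + b2) * (b1 * t / (4 * a1 * A)) + c by rewrite /M; ring.
rewrite /gauss2/= !mulrA; congr (_ * _ * cos _); first exact: mulrAC.
by rewrite /gauss; congr (expR (- _)); field; rewrite gt_eqF.
Qed.
End gaussian_plane.

(** * Wave packets and their evolution *)

Lemma cisD (R : realType) (x y : R) : cis (x + y) = cis x * cis y.
Proof. by rewrite /cis cosD sinD; congr Complex; rewrite addrC. Qed.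

(** The datum, its transform and all its evolutions have this form, so modulus, measurability and
    L^p bounds are settled once, whatever the phase. *)
Definition packet (R : realType) (K a1 m1 a2 m2 : R) (ph : R * R -> R)
    (z : R * R) : R[i] :=
  cis (ph z) * Complex (K * gauss2 a1 m1 a2 m2 z) 0.

Section packets.
Context {R : realType}.
Implicit Types a b c m t K : R.
Local Notation mu := (@lebesgue_measure R).

Lemma packetE K a1 m1 a2 m2 ph z : packet K a1 m1 a2 m2 ph z =
  Complex (cos (ph z) * (K * gauss2 a1 m1 a2 m2 z))
          (sin (ph z) * (K * gauss2 a1 m1 a2 m2 z)).
Proof. by rewrite /packet /cis; congr Complex; rewrite mulr0 ?subr0 ?add0r. Qed.

Lemma normc_packet K a1 m1 a2 m2 ph z : 0 <= K ->
  Normc.normc (packet K a1 m1 a2 m2 ph z) = K * gauss2 a1 m1 a2 m2 z.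
Proof.
move=> K0; rewrite Normc.normcM /= cos2Dsin2 sqrtr1 mul1r expr0n /= addr0.
by rewrite sqrtr_sqr ger0_norm// mulr_ge0 ?gauss2_ge0.
Qed.

Lemma cmeasurable_packet K a1 m1 a2 m2 (ph : R * R -> R) :
  measurable_fun setT ph -> cmeasurable (packet K a1 m1 a2 m2 ph).
Proof.
move=> mph; have mg := measurable_gauss2 a1 m1 a2 m2.
split; under eq_fun do rewrite packetE /=.
  apply: measurable_funM; last exact: measurable_funM.
  apply: measurableT_comp => //.
  by apply: continuous_measurable_fun; exact: continuous_cos.
apply: measurable_funM; last exact: measurable_funM.
apply: measurableT_comp => //.
by apply: continuous_measurable_fun; exact: continuous_sin.
Qed.

Lemma powR_gauss a m x p : gauss a m x `^ p = gauss (a * p) m x.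
Proof. by rewrite /gauss -expRM mulNr mulrAC. Qed.

Lemma cLp_packet K a1 m1 a2 m2 (ph : R * R -> R) p :
  measurable_fun setT ph -> 0 <= K -> 0 < a1 -> 0 < a2 -> 0 < p ->
  cLp p (packet K a1 m1 a2 m2 ph).
Proof.
move=> mph K0 a10 a20 p0; split; first exact: cmeasurable_packet.
rewrite /cLnorm unlock; apply: poweR_lty.
have E z : (`|(Normc.normc (packet K a1 m1 a2 m2 ph z))%:E| `^ p =
  (K `^ p)%:E * (gauss2 (a1 * p) m1 (a2 * p) m2 z)%:E)%E.
  rewrite normc_packet//= ger0_norm; last by rewrite mulr_ge0 ?gauss2_ge0.
  rewrite -EFinM; congr EFin; rewrite powRM ?gauss2_ge0//; congr (_ * _).
  by rewrite /gauss2 (powRM _ (gauss_ge0 _ _ _) (gauss_ge0 _ _ _)) !powR_gauss.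
under eq_integral do rewrite E.
rewrite integralZl ?integral_gauss2 ?mulr_gt0 ?ltry//.
by apply: integrable_gauss2; rewrite mulr_gt0.
Qed.

(** Both components come from [integral_gauss2_cos], with constant phase 0 for the real part and -
    pi / 2 for the imaginary part. As a function of the frequencies the result is again a packet. *)
Lemma cintegral_packet K a1 m1 a2 b1 b2 t : 0 < a1 -> 0 < a2 ->
  let A := a2 + t ^+ 2 / (4 * a1) in
  cintegral (packet K a1 m1 a2 0
    (fun z => b1 * z.1 + b2 * z.2 + t * (z.1 * z.2))) =
  packet (K * (Num.sqrt (pi / a1) * Num.sqrt (pi / A)))
    (a2 / (4 * a1 * A)) 0 (4 * A)^-1 (- (t * m1))
    (fun z => z.1 * m1 - (t * m1 + z.2) * (z.1 * t / (4 * a1 * A))) (b1, b2).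
Proof.
move=> a10 a20 A; pose ph (z : R * R) := b1 * z.1 + b2 * z.2 + t * (z.1 * z.2).
have A0 : 0 < A by rewrite ltr_wpDr// divr_ge0 ?sqr_ge0// mulr_ge0// ltW.
have I c : Rintegral (mu2 R) setT
    (fun z => cos (ph z + c) * (K * gauss2 a1 m1 a2 0 z)) =
  cos (b1 * m1 - (t * m1 + b2) * (b1 * t / (4 * a1 * A)) + c) *
  (K * (Num.sqrt (pi / a1) * Num.sqrt (pi / A)) *
   gauss2 (a2 / (4 * a1 * A)) 0 (4 * A)^-1 (- (t * m1)) (b1, b2)).
  under eq_Rintegral do rewrite mulrC -mulrA.
  rewrite RintegralZl ?integral_gauss2_cos//; first by rewrite /A; ring.
  apply: integrable_gauss2_cos => //.
rewrite packetE /cintegral; congr Complex.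
  have := I 0; rewrite addr0 => <-; apply: eq_Rintegral => z _.
  by rewrite packetE addr0.
have sinE x : sin x = cos (x - pi / 2) :> R.
  by rewrite cosB cos_pihalf sin_pihalf mulr0 mulr1 add0r.
by rewrite sinE -I; apply: eq_Rintegral => z _; rewrite packetE /= sinE.
Qed.

(** * The datum, its Fourier transform and its evolution *)

Lemma L2_extension_id (T : (R * R -> R[i]) -> (R * R -> R[i])) f :
  cLp 1 f -> cLp 2 f -> cLp 2 (T f) -> L2_extension T f (T f).
Proof.
have d0 g : cvgL2 (fun _ : nat => g) g.
  rewrite /cvgL2 (_ : (fun _ => _) = cst 0%E); first exact: cvg_cst.
  apply/funext => k; rewrite /cLnorm.
  under eq_Lnorm do rewrite subrr Normc.normc0.
  by rewrite Lnorm0.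
by move=> f1 f2 Tf2; split => //; exists (fun=> f); split.
Qed.

Definition wave_hat N : R * R -> R[i] :=
  packet 1 2^-1 N (2 * N ^+ 2)^-1 0 (fun=> 0).

(** The closed form of the evolution at t = 0; [fourier_wave] verifies that its transform is
    [wave_hat N]. *)
Definition wave N : R * R -> R[i] :=
  packet (2 * pi * N) 2^-1 0 (N ^+ 2 / 2) 0 (fun z => N * z.1).

Definition evolution N t : R * R -> R[i] :=
  inverse_fourier (fun xi => cis (t * (xi.1 * xi.2)) * wave_hat N xi).

(** With T = t N, the packet is centred at x2 = - T; both widths are multiplied by sqrt (1 + T^2)
    and the height is divided by it. Dispersion is thus harmless while T stays bounded. *)
Lemma evolutionE N t : 0 < N ->
  evolution N t =
  packet (2 * pi * N / Num.sqrt (1 + (t * N) ^+ 2)) (2 * (1 + (t * N) ^+ 2))^-1 0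
    (N ^+ 2 / (2 * (1 + (t * N) ^+ 2))) (- (t * N))
    (fun z => z.1 * N -
      (t * N + z.2) * (z.1 * t * N ^+ 2 / (1 + (t * N) ^+ 2))).
Proof.
move=> N0; apply/funext => x; have a0 : 0 < (2 * N ^+ 2)^-1 by rewrite invr_gt0 mulr_gt0 ?exprn_gt0.
transitivity (cintegral (packet 1 2^-1 N (2 * N ^+ 2)^-1 0
    (fun z => x.1 * z.1 + x.2 * z.2 + t * (z.1 * z.2)))).
  rewrite /evolution /inverse_fourier; congr cintegral; apply/funext => z.
  by rewrite /wave_hat /packet mulrA -cisD mulrA -cisD addr0.
have T0 : 0 < 1 + (t * N) ^+ 2 by rewrite ltr_pwDl ?sqr_ge0.
have TN : (1 + (t * N) ^+ 2 != 0) && (N != 0) by rewrite !gt_eqF//.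
rewrite cintegral_packet//; case: x => x1 x2; rewrite /packet /=.
set A := _^-1 + _.
have AE : A = (1 + (t * N) ^+ 2) / (2 * N ^+ 2) by rewrite /A; field; rewrite gt_eqF.
congr (cis _ * Complex (_ * _) 0).
- by rewrite AE; field.
- rewrite mul1r AE -sqrtrM ?mulr_ge0 ?pi_ge0//.
  rewrite (_ : pi / 2^-1 * _ = (2 * pi * N) ^+ 2 * (1 + (t * N) ^+ 2)^-1).
    rewrite sqrtrM ?sqr_ge0// sqrtrV ?ltW// sqrtr_sqr ger0_norm//.
    by rewrite !mulr_ge0 ?pi_ge0 ?ltW.
  by field.
- have e1 : (2 * N ^+ 2)^-1 / (4 / 2 * A) = (2 * (1 + (t * N) ^+ 2))^-1.
    by rewrite AE; field.
  have e2 : (4 * A)^-1 = N ^+ 2 / (2 * (1 + (t * N) ^+ 2)).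
    by rewrite AE; field.
  by rewrite e1 e2.
Qed.

Lemma fourier_wave N : 0 < N -> fourier (wave N) = wave_hat N.
Proof.
move=> N0; apply/funext => -[x1 x2]; rewrite /fourier.
transitivity (Complex ((2 * pi) ^- 2) 0 *
  cintegral (packet (2 * pi * N) 2^-1 0 (N ^+ 2 / 2) 0
    (fun z => (N - x1) * z.1 + (- x2) * z.2 + 0 * (z.1 * z.2)))).
  congr (_ * cintegral _); apply/funext => z.
  by rewrite /wave /packet mulrA -cisD; congr (cis _ * _); rewrite /dot/=; ring.
rewrite cintegral_packet ?divr_gt0 ?exprn_gt0//.
set A := _ + _; have AE : A = N ^+ 2 / 2 by rewrite /A expr0n/= mul0r addr0.
rewrite /wave_hat /packet /= mulrCA; congr (cis _ * _).
  by rewrite !(mulr0, mul0r) subr0.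
rewrite -sqrtrM ?mulr_ge0 ?pi_ge0// AE.
rewrite (_ : pi / 2^-1 * _ = (2 * pi / N) ^+ 2); last by field; rewrite gt_eqF.
rewrite sqrtr_sqr ger0_norm; last by rewrite !mulr_ge0 ?invr_ge0 ?pi_ge0 ?ltW.
congr Complex; last by rewrite mulr0 mul0r addr0.
have e : (2 * pi) ^- 2 * (2 * pi * N * (2 * pi / N)) = 1 :> R.
  by have := pi_gt0 R; move: pi => p p0; field; rewrite !gt_eqF.
have e1 : N ^+ 2 / 2 / (4 / 2 * (N ^+ 2 / 2)) = 2^-1 by field; rewrite gt_eqF.
have e2 : (4 * (N ^+ 2 / 2))^-1 = (2 * N ^+ 2)^-1 by field; rewrite gt_eqF.
rewrite mulr0 subr0 [LHS]mulrA e !mul1r /gauss2/= e1 e2 ?mul0r oppr0 /gauss !subr0.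
by rewrite -(opprB N x1) !sqrrN.
Qed.

Lemma cLp_wave N p : 0 < N -> 0 < p -> cLp p (wave N).
Proof.
move=> N0 p0; apply: cLp_packet => //; last by rewrite divr_gt0 ?exprn_gt0.
  exact: measurable_funM.
by rewrite !mulr_ge0 ?pi_ge0// ltW.
Qed.

Lemma cLp_wave_hat N p : 0 < N -> 0 < p -> cLp p (wave_hat N).
Proof.
by move=> N0 p0; apply: cLp_packet => //; rewrite invr_gt0 mulr_gt0 ?exprn_gt0.
Qed.

Lemma L2_fourier_wave N : 0 < N -> L2_extension (@fourier R) (wave N) (wave_hat N).
Proof.
move=> N0; rewrite -fourier_wave//; apply: L2_extension_id; try exact: cLp_wave.
by rewrite fourier_wave//; exact: cLp_wave_hat.
Qed.

Lemma measurable_evolution_phase N t b c : measurable_fun setT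
  (fun z : R * R => z.1 * N - (b + z.2) * (z.1 * t * N ^+ 2 / c)).
Proof.
apply: measurable_funB; first exact: measurable_funM.
apply: measurable_funM; first exact: measurable_funD.
by apply: measurable_funM => //; apply: measurable_funM => //; exact: measurable_funM.
Qed.

Lemma cmeasurable_evolution N t : 0 < N -> cmeasurable (evolution N t).
Proof.
move=> N0; rewrite evolutionE//.
by apply: cmeasurable_packet; exact: measurable_evolution_phase.
Qed.

Lemma propagator_wave N t : 0 < N -> propagator t (wave N) (evolution N t).
Proof.
move=> N0; exists (wave_hat N); split; first exact: L2_fourier_wave.
have E : (fun xi => cis (t * (xi.1 * xi.2)) * wave_hat N xi) =
    packet 1 2^-1 N (2 * N ^+ 2)^-1 0 (fun xi => t * (xi.1 * xi.2)).
  by apply/funext => xi; rewrite /wave_hat /packet mulrA -cisD addr0.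
have a0 : 0 < (2 * N ^+ 2)^-1 by rewrite invr_gt0 mulr_gt0 ?exprn_gt0.
have mph : measurable_fun setT (fun xi : R * R => t * (xi.1 * xi.2)).
  by apply: measurable_funM => //; exact: measurable_funM.
apply: L2_extension_id; try by rewrite E; exact: cLp_packet.
have T0 : 0 < 2 * (1 + (t * N) ^+ 2) by rewrite mulr_gt0 ?ltr_pwDl ?sqr_ge0.
rewrite -/(evolution N t) evolutionE//.
apply: cLp_packet => //.
- exact: measurable_evolution_phase.
- by rewrite divr_ge0 ?sqrtr_ge0// !mulr_ge0 ?pi_ge0// ltW.
- by rewrite invr_gt0.
- by rewrite divr_gt0// exprn_gt0.
Qed.
End packets.

(** * Norms *)

Section norms.
Context {R : realType}.
Implicit Types N s h c : R.
Local Notation mu := (@lebesgue_measure R).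

Lemma normc_wave_hat N x :
  Normc.normc (wave_hat N x) = gauss2 2^-1 N (2 * N ^+ 2)^-1 0 x.
Proof. by rewrite normc_packet// mul1r. Qed.

(** With p + q the exponent of the Gaussian on the left, 1 + |x|^2 <= 3 N^2 exp (p + q). The power s
    <= 1/2 costs at most exp ((p + q) / 2), which half of the Gaussian absorbs. The second exponent
    [s] serves a possibly negative [s'], for which it is taken to be 0. *)
Lemma bracket_powR_le N s' s (x : R * R) :
  1 <= N -> s' <= s -> 0 <= s -> s <= 2^-1 ->
  (1 + dot x x) `^ s' * gauss2 1 N (N ^+ 2)^-1 0 x <=
  (3 * N ^+ 2) `^ s * gauss2 2^-1 N (2 * N ^+ 2)^-1 0 x.
Proof.
move=> N1 s's s0 s2; case: x => x1 x2; rewrite /dot /gauss2 /gauss /= subr0.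
have N0 : 0 < N by apply: lt_le_trans N1.
have N20 : 0 < N ^+ 2 by rewrite exprn_gt0.
pose p := (x1 - N) ^+ 2; pose q := x2 ^+ 2 / N ^+ 2.
have p0 : 0 <= p by exact: sqr_ge0.
have q0 : 0 <= q by rewrite divr_ge0 ?sqr_ge0 ?ltW.
have base : 1 + (x1 * x1 + x2 * x2) <= 3 * N ^+ 2 * expR (p + q).
  apply: (@le_trans _ _ (3 * N ^+ 2 * (1 + (p + q)))); last first.
    by rewrite ler_wpM2l ?expR_ge1Dx// mulr_ge0 ?sqr_ge0.
  have -> : 3 * N ^+ 2 * (1 + (p + q)) =
      3 * N ^+ 2 + 3 * N ^+ 2 * p + 3 * x2 ^+ 2 by rewrite /q; field; rewrite gt_eqF.
  have NN : 1 <= N ^+ 2 by rewrite exprn_ege1.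
  have : p <= N ^+ 2 * p by rewrite ler_peMl.
  (* The first square expresses x1^2 <= 2 (x1 - N)^2 + 2 N^2. *)
  have := sqr_ge0 (x1 - 2 * N); have := sqr_ge0 x2.
  by move: p0 NN; rewrite /p; lra.
have b0 : 0 <= 1 + (x1 * x1 + x2 * x2) by nra.
have base0 : 0 <= 3 * N ^+ 2 * expR (p + q) by exact: le_trans base.
apply: (@le_trans _ _ ((3 * N ^+ 2 * expR (p + q)) `^ s *
    (expR (- (1 * p)) * expR (- ((N ^+ 2)^-1 * x2 ^+ 2))))).
  rewrite ler_wpM2r ?mulr_ge0 ?expR_ge0//.
  apply: (@le_trans _ _ ((1 + (x1 * x1 + x2 * x2)) `^ s)).
    by apply: ler_powR => //; nra.
  by rewrite ge0_ler_powR// nnegrE.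
have h3 : 0 <= 3 * N ^+ 2 by rewrite mulr_ge0 ?sqr_ge0.
rewrite (powRM _ h3 (expR_ge0 _)) -mulrA ler_wpM2l ?powR_ge0//.
rewrite -expRM -!expRD ler_expR.
rewrite (_ : (2 * N ^+ 2)^-1 * x2 ^+ 2 = q / 2); last by rewrite /q; field; rewrite gt_eqF.
rewrite (_ : (N ^+ 2)^-1 * x2 ^+ 2 = q); last by rewrite mulrC.
rewrite -/p; nra.
Qed.

(** The squared integrand is the left side of [bracket_powR_le], and the Gaussian on its right side
    has mass 2 pi N. The bound is of order N^(s + 1/2). *)
Lemma sobolev_norm_wave_hat N s' s :
  1 <= N -> s' <= s -> 0 <= s -> s <= 2^-1 ->
  (sobolev_norm s' (wave_hat N) <=
    (((3 * N ^+ 2) `^ s * (2 * pi * N)) `^ 2^-1)%:E)%E.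
Proof.
move=> N1 s's s0 s2; rewrite /sobolev_norm unlock -poweR_EFin.
have N0 : 0 < N by apply: lt_le_trans N1.
have a0 : 0 < (2 * N ^+ 2)^-1 by rewrite invr_gt0 mulr_gt0 ?exprn_gt0.
have E x : (`|((1 + dot x x) `^ (s' / 2) * Normc.normc (wave_hat N x))%:E| `^ 2 =
   ((1 + dot x x) `^ s' * gauss2 1 N (N ^+ 2)^-1 0 x)%:E)%E.
  rewrite normc_wave_hat /=; congr EFin.
  rewrite (ger0_norm (mulr_ge0 (powR_ge0 _ _) (gauss2_ge0 _ _ _ _ _))).
  rewrite (powRM _ (powR_ge0 _ _) (gauss2_ge0 _ _ _ _ _)) -powRrM divfK//; congr (_ * _).
  rewrite /gauss2 (powRM _ (gauss_ge0 _ _ _) (gauss_ge0 _ _ _)) !powR_gauss.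
  have -> : (2 * N ^+ 2)^-1 * 2 = (N ^+ 2)^-1 by field; rewrite gt_eqF.
  by rewrite mulVf.
apply: gt0_ler_poweR => //.
- by rewrite in_itv/= leey integral_ge0// => x _; exact: poweR_ge0.
- by rewrite in_itv/= leey lee_fin !mulr_ge0 ?powR_ge0 ?pi_ge0 ?ltW.
under eq_integral do rewrite E.
apply: (@le_trans _ _ (\int[mu2 R]_x
    ((3 * N ^+ 2) `^ s * gauss2 2^-1 N (2 * N ^+ 2)^-1 0 x)%:E)%E).
  apply: ge0_le_integral => //.
  - by move=> x _; rewrite lee_fin (mulr_ge0 (powR_ge0 _ _) (gauss2_ge0 _ _ _ _ _)).
  - apply/measurable_EFinP; apply: measurable_funM; last exact: measurable_gauss2.
    apply: measurableT_comp (measurable_powR s') _.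
    apply: measurable_funD => //.
    by apply: measurable_funD; exact: measurable_funM.
  - apply/measurable_EFinP; apply: measurable_funM => //; exact: measurable_gauss2.
  - by move=> x _; rewrite lee_fin; exact: bracket_powR_le.
under eq_integral do rewrite EFinM.
rewrite integralZl//; last exact: integrable_gauss2.
rewrite integral_gauss2// -EFinM lee_fin ler_wpM2l ?powR_ge0//.
rewrite -sqrtrM ?mulr_ge0 ?pi_ge0//.
rewrite (_ : pi / 2^-1 * _ = (2 * pi * N) ^+ 2); last by field; rewrite gt_eqF.
by rewrite sqrtr_sqr ger0_norm// !mulr_ge0 ?pi_ge0 ?ltW.
Qed.

(** * Measurability and a lower bound for the maximal function *)

Lemma measurable_unit_ball : measurable (@unit_ball R).
Proof.
rewrite (_ : @unit_ball R = (fun x => dot x x) @^-1` `]-oo, 1[).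
  rewrite -[X in measurable X]setTI.
  apply: (measurable_funD (D := setT) _ _) => //; exact: measurable_funM.
by apply/seteqP; split => x /=; rewrite in_itv.
Qed.

Lemma measurable_maximal_function (u : nat -> R * R -> R[i]) :
  (forall n, cmeasurable (u n)) -> measurable_fun setT (maximal_function u).
Proof.
move=> mu_; rewrite (_ : maximal_function u =
  (fun x => esups ((fun n x => (Normc.normc (u n x))%:E)^~ x) 0%N)).
  apply: measurable_fun_esups => n; apply/measurable_EFinP.
  have [mr mi] := mu_ n.
  rewrite (_ : (fun x => Normc.normc (u n x)) =
    (fun x => Num.sqrt (complex.Re (u n x) ^+ 2 + complex.Im (u n x) ^+ 2))).
    apply: measurableT_comp; last first.
      by apply: measurable_funD; exact: measurable_funX.
    by apply: continuous_measurable_fun; exact: sqrt_continuous.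
  by apply/funext => x; case: (u n x).
apply/funext => x; congr ereal_sup; apply/seteqP; split => y /=.
  by move=> [n _ <-]; exists n.
by move=> [n _ <-]; exists n.
Qed.

(** Chebyshev's inequality for the maximal function; the index [n] may vary with the point. *)
Lemma Lnorm_maximal_ge (u : nat -> R * R -> R[i]) (E : set (R * R)) c :
  (forall n, cmeasurable (u n)) -> measurable E -> E `<=` @unit_ball R ->
  0 <= c -> (forall x, E x -> exists n, c <= Normc.normc (u n x)) ->
  ((((c ^+ 2)%:E * mu2 R E) `^ 2^-1) <=
    'N[mu2 R]_2%:E [maximal_function u \_ (@unit_ball R)])%E.
Proof.
move=> mu_ mE EB c0 cu; rewrite unlock.
apply: gt0_ler_poweR => //.
- by rewrite in_itv/= leey mule_ge0// lee_fin sqr_ge0.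
- by rewrite in_itv/= leey integral_ge0// => x _; exact: poweR_ge0.
rewrite -integral_cst// integral_mkcond.
apply: ge0_le_integral => //.
- by move=> x _; rewrite patchE; case: ifP => // _; rewrite lee_fin sqr_ge0.
- apply: (measurable_restrictT (cst (c ^+ 2)%:E) mE).1; exact: measurable_cst.
- apply: (@measurableT_comp _ _ _ _ _ _ (fun y => y `^ 2)%E).
    exact: measurable_poweR.
  apply: measurableT_comp => //.
  apply: (measurable_restrictT (maximal_function u) measurable_unit_ball).1.
  exact: measurable_funTS (measurable_maximal_function mu_).
- move=> x _; rewrite patchE; case: ifPn => [/set_mem Ex|_]; last exact: poweR_ge0.
  rewrite patchE ifT; last by apply/mem_set; exact: EB.
  have [n cn] := cu x Ex.
  rewrite -(powR_mulrn 2 c0) -poweR_EFin; apply: gt0_ler_poweR => //.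
  + by rewrite in_itv/= leey lee_fin c0.
  + by rewrite in_itv/= leey abse_ge0.
  apply: (le_trans _ (lee_abs _)).
  apply: (@le_trans _ _ (Normc.normc (u n x))%:E); first by rewrite lee_fin.
  by apply: ereal_sup_ubound; exists n.
Qed.
End norms.

(** * The sequence of times *)

(** Borderline for the weak space: for small b, about b^(-r) terms exceed b. *)
Definition times (R : realType) (r : R) (n : nat) : R := n.+1%:R `^ (- r^-1).

Section times.
Context {R : realType}.
Variable r : R.
Hypotheses (r0 : 0 < r) (r1 : r <= 1).

Lemma times_ge0 n : 0 <= times r n.
Proof. exact: powR_ge0. Qed.

Lemma decreasing_times : decreasing_seq (times r).
Proof.
have ri0 : 0 < r^-1 by rewrite invr_gt0.
apply/decreasing_seqP => n.
rewrite /times !powRN ltf_pV2 ?posrE ?powR_gt0//.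
by rewrite gt0_ltr_powR// ?nnegrE// ltr_nat.
Qed.

Lemma cvg_times : times r @ \oo --> 0.
Proof.
apply: (squeeze_cvgr _ (cvg_cst 0) (@cvg_harmonic R)); apply: nearW => n.
rewrite times_ge0 /times powRN /harmonic lef_pV2 ?posrE ?powR_gt0//.
by rewrite le1r_powR ?ler1n// invf_ge1.
Qed.

(** The supremum is at most 1: b < (n+1)^(-1/r) forces n + 1 <= b^(-r), so [n] is below the integer
    part of b^(-r). *)
Lemma weak_ell_times : weak_ell r (times r).
Proof.
apply: (@le_lt_trans _ _ 1%E); last exact: ltry.
apply: ge_ereal_sup => _ [b /= b0 <-].
have b0' : 0 <= b by exact: ltW.
pose M := Num.truncn (b `^ (- r)).
have sub : [set n | b < times r n] `<=` `I_M.
  move=> n /= bn; rewrite truncn_gt_nat.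
  have -> : n.+1%:R = times r n `^ (- r) :> R.
    by rewrite /times -powRrM mulrNN mulVf ?gt_eqF// powRr1.
  rewrite !powRN lef_pV2 ?posrE ?powR_gt0//.
  by rewrite ge0_ler_powR ?nnegrE ?times_ge0// ltW.
have fin : finite_set [set n | b < times r n] by exact: sub_finite_set sub (finite_II _).
rewrite /counting asboolT// -EFinM lee_fin.
have cM : (#|` fset_set [set n | b < times r n]|)%fset%:R <= b `^ (- r).
  apply: (@le_trans _ _ M%:R); last by rewrite truncn_le powR_ge0.
  by rewrite ler_nat; apply: geq_card_fset_set; exact: subset_card_le.
apply: (@le_trans _ _ (b `^ r * b `^ (- r))).
  by rewrite ler_wpM2l ?powR_ge0.
by rewrite powRN divff// gt_eqF// powR_gt0.
Qed.

(** A mean value bound, from y^(-p) = x^(-p) exp (- p ln (y / x)) with ln (1 + u) <= u and 1 + u <=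
    exp u. *)
Lemma powR_decrement_le (p x y : R) : 0 <= p -> 0 < x -> x <= y <= x + 1 ->
  x `^ (- p) - y `^ (- p) <= p * x `^ (- (p + 1)).
Proof.
move=> p0 x0 /andP[xy yx1].
have y0 : 0 < y by exact: lt_le_trans xy.
have xN0 : x != 0 by rewrite gt_eqF.
have yx0 : 0 < y / x by rewrite divr_gt0.
have yE : y `^ (- p) = x `^ (- p) * expR (- p * ln (y / x)).
  rewrite -{1}(divfK xN0 y) powRM ?ltW// mulrC; congr (_ * _).
  by rewrite {1}/powR gt_eqF.
have lnb : ln (y / x) <= x^-1.
  have -> : y / x = 1 + (y - x) / x by field.
  have yx : 0 <= (y - x) / x by rewrite divr_ge0 ?subr_ge0// ltW.
  apply: le_trans (le_ln1Dx _) _; first exact: lt_le_trans (ltrN10 _) yx.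
  by rewrite ler_pdivrMr// mulVf// lerBlDl.
have : 1 - p / x <= expR (- p * ln (y / x)).
  apply: le_trans (expR_ge1Dx _); rewrite lerD2l mulNr lerN2.
  by rewrite ler_wpM2l.
rewrite yE opprD powRD ?xN0 ?implybT// (powR_inv1 (ltW x0)).
move=> h; rewrite -{1}(mulr1 (x `^ _)) -mulrBr mulrCA ler_wpM2l ?powR_ge0//.
by move: h; move: (expR _) (p / x) => e q; lra.
Qed.

(* On the scale N^-2, the gaps of the times below N^(-2/(1+r)): with t = m^(-1/r)
   they are at most r^-1 m^(-1/r-1), and the factor 2^(r^-1+1) pays for the
   truncation of tau^(-r) to the integer m. *)
Definition spacing_constant : R := r^-1 * 2 `^ (r^-1 + 1).

(** Put X = tau^(-r) and let m be its integer part. The time m^(-1/r) is at least tau = X^(-1/r),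
    and since X < m + 1 its excess is bounded by [powR_decrement_le]. *)
Lemma times_dense (N tau : R) : 1 <= N -> 0 < tau -> tau <= N `^ (- (2 / (1 + r))) ->
  exists n, tau <= times r n <= tau + spacing_constant / N ^+ 2.
Proof.
move=> N1 t0 tN.
have N0 : 0 < N by exact: lt_le_trans N1.
have ri0 : 0 < r^-1 by rewrite invr_gt0.
pose X := tau `^ (- r).
have X1 : 1 <= X.
  rewrite /X powRN -[leLHS]invr1 lef_pV2 ?posrE ?powR_gt0//.
  have tau1 : tau <= 1.
    apply: (le_trans tN); rewrite powRN -[leRHS]invr1 lef_pV2 ?posrE ?powR_gt0//.
    by rewrite -[leLHS](powRr0 N) ler_powR// divr_ge0// addr_ge0// ltW.
  apply: (@le_trans _ _ (1 `^ r)); last by rewrite powR1.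
  by rewrite ge0_ler_powR ?nnegrE// ltW.
have X0 : 0 <= X by exact: le_trans X1.
have /andP[mX Xm] := truncn_itv X0.
have m0 : (0 < Num.truncn X)%N by rewrite truncn_gt_nat.
exists (Num.truncn X).-1; rewrite /times prednK//.
move: mX Xm m0; move: (Num.truncn X) => m mX Xm m0.
have m0' : 0 < m%:R :> R by rewrite ltr0n.
have Xtau : X `^ (- r^-1) = tau.
  by rewrite /X -powRrM mulrNN divff ?gt_eqF// powRr1// ltW.
have Xp : 0 < X by exact: lt_le_trans X1.
apply/andP; split.
  rewrite -[leLHS]Xtau !powRN lef_pV2 ?posrE ?powR_gt0//.
  by rewrite ge0_ler_powR// ?nnegrE// ltW.
have h1 : m%:R `^ (- r^-1) - tau <= r^-1 * m%:R `^ (- (r^-1 + 1)).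
  rewrite -Xtau; apply: powR_decrement_le => //; first exact: ltW.
  by rewrite mX natr1 ltW.
have h2 : m%:R `^ (- (r^-1 + 1)) <= 2 `^ (r^-1 + 1) / N ^+ 2.
  have Xm2 : X <= 2 * m%:R.
    apply: (le_trans (ltW Xm)); rewrite -natr1 mulr_natl mulr2n lerD2l.
    by rewrite ler1n.
  have q0 : 0 <= r^-1 + 1 by rewrite addr_ge0// ltW.
  have h3 : X `^ (r^-1 + 1) <= 2 `^ (r^-1 + 1) * m%:R `^ (r^-1 + 1).
    by rewrite -powRM// ge0_ler_powR// nnegrE// mulr_ge0.
  (* The threshold on tau enters here: X^(1/r + 1) = tau^(-(1 + r)) >= N^2. *)
  have h4 : N ^+ 2 <= X `^ (r^-1 + 1).
    rewrite /X -powRrM.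
    rewrite (_ : - r * (r^-1 + 1) = - (1 + r)); last by field; rewrite gt_eqF.
    rewrite powRN -[leLHS]invrK lef_pV2 ?posrE ?invr_gt0 ?powR_gt0 ?exprn_gt0//.
    apply: (@le_trans _ _ ((N `^ (- (2 / (1 + r)))) `^ (1 + r))).
      by rewrite ge0_ler_powR ?nnegrE ?powR_ge0 ?addr_ge0// ltW.
    rewrite -powRrM mulNr divfK; last by rewrite gt_eqF// addr_gt0.
    by rewrite powRN powR_mulrn// ltW.
  rewrite powRN -[leLHS]div1r ler_pdivrMr ?powR_gt0// mulrAC.
  by rewrite ler_pdivlMr ?exprn_gt0// mul1r (le_trans h4).
rewrite -lerBlDl; apply: (le_trans h1).
by rewrite /spacing_constant -mulrA ler_wpM2l// ltW.
Qed.
End times.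

(** * The counterexample *)

Section counterexample.
Context {R : realType}.
Implicit Types N s h c K : R.
Local Notation mu := (@lebesgue_measure R).

(* A lower bound for |e^{it[]} f| / N when t N <= 1 + K, on the part |x1| <= 1 of
   the strip of half-width K / N around the center x2 = - t N of the packet. *)
Definition amplitude K : R :=
  2 * pi / Num.sqrt (1 + (1 + K) ^+ 2) * (expR (-1) * expR (- K ^+ 2)).

Lemma amplitude_gt0 K : 0 < amplitude K.
Proof.
by rewrite !mulr_gt0 ?invr_gt0 ?sqrtr_gt0 ?expR_gt0 ?pi_gt0// ltr_pwDl// sqr_ge0.
Qed.

(** The factors of [evolutionE] are bounded separately: the height by T <= 1 + K, the two Gaussians
    by dropping the divisor 2 (1 + T^2) >= 1 from their rates. *)
Lemma evolution_ge K N t (x : R * R) : 1 <= N -> 0 <= t * N -> t * N <= 1 + K ->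
  `|x.1| <= 1 -> `|x.2 + t * N| <= K / N ->
  amplitude K * N <= Normc.normc (evolution N t x).
Proof.
move=> N1 T0 TK x1 x2; have N0 : 0 < N by exact: lt_le_trans N1.
have K0 : 0 <= K by rewrite -(pmulr_lge0 _ (_ : 0 < N^-1)) ?invr_gt0// (le_trans _ x2).
rewrite evolutionE//; set T := t * N in T0 TK x2 *.
have S1 : 1 <= 1 + T ^+ 2 by rewrite lerDl sqr_ge0.
have S0 : 0 < 1 + T ^+ 2 by exact: lt_le_trans S1.
have S2 : 1 <= 2 * (1 + T ^+ 2) by lra.
have S20 : 0 < 2 * (1 + T ^+ 2) by exact: lt_le_trans S2.
rewrite normc_packet; last by rewrite !mulr_ge0 ?invr_ge0 ?sqrtr_ge0 ?pi_ge0 ?ltW.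
rewrite /amplitude mulrAC [leRHS](_ : _ = 2 * pi / Num.sqrt (1 + T ^+ 2) * N *
  gauss2 (2 * (1 + T ^+ 2))^-1 0 (N ^+ 2 / (2 * (1 + T ^+ 2))) (- T) x); last first.
  by congr (_ * _); rewrite mulrAC.
have g1 : expR (-1) <= gauss (2 * (1 + T ^+ 2))^-1 0 x.1.
  have i1 : (2 * (1 + T ^+ 2))^-1 <= 1 by rewrite invf_le1.
  have i2 : x.1 ^+ 2 <= 1 by rewrite -(real_normK (num_real _)) exprn_ile1.
  by rewrite ler_expR lerN2 subr0 mulr_ile1 ?sqr_ge0 ?invr_ge0 ?(ltW S20).
have g2 : expR (- K ^+ 2) <= gauss (N ^+ 2 / (2 * (1 + T ^+ 2))) (- T) x.2.
  rewrite ler_expR lerN2 opprK -(real_normK (num_real (x.2 + T))).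
  apply: (@le_trans _ _ (N ^+ 2 * (K / N) ^+ 2)).
    have i1 : N ^+ 2 / (2 * (1 + T ^+ 2)) <= N ^+ 2.
      by rewrite ler_pdivrMr// ler_peMr// sqr_ge0.
    have i2 : `|x.2 + T| ^+ 2 <= (K / N) ^+ 2.
      by rewrite lerXn2r ?nnegrE ?divr_ge0// ltW.
    by apply: ler_pM; rewrite ?sqr_ge0 ?divr_ge0 ?sqr_ge0 ?(ltW S20).
  by rewrite -exprMn mulrCA divff ?mulr1// gt_eqF.
apply: ler_pM.
- by rewrite !mulr_ge0 ?invr_ge0 ?sqrtr_ge0 ?pi_ge0 ?(ltW N0).
- by rewrite mulr_ge0 ?expR_ge0.
- rewrite ler_wpM2r ?(ltW N0)// ler_wpM2l ?mulr_ge0 ?pi_ge0//.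
  rewrite lef_pV2 ?posrE ?sqrtr_gt0//; last by rewrite ltr_pwDl ?sqr_ge0.
  by rewrite ler_wsqrtr// lerD2l lerXn2r ?nnegrE ?addr_ge0.
- by apply: ler_pM => //; exact: expR_ge0.
Qed.

Lemma measure_rectangle (a h : R) : 0 < a -> 0 < h ->
  mu2 R (`[0, a] `*` `[- h, 0[) = (a * h)%:E.
Proof.
move=> a0 h0.
rewrite product_measure1E; [|exact: measurable_itv..].
rewrite /= !lebesgue_measure_itv/= !lte_fin a0 oppr_lt0 h0.
by rewrite -!EFinB -EFinM subr0 sub0r opprK.
Qed.

(** The squared maximal estimate for [wave N], with the left side bounded below on a rectangle swept
    by the packet and the right side bounded by [sobolev_norm_wave_hat]. *)
Lemma maximal_estimate_wave r s' s C N :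
  0 < r -> r <= 1 -> 1 <= N -> s' <= s -> 0 <= s -> s <= 2^-1 ->
  (forall (f fhat : R * R -> R[i]) (u : nat -> R * R -> R[i]),
    sobolev s' f fhat ->
    (forall n, propagator (times r n) f (u n)) ->
    ('N[mu2 R]_2%:E [maximal_function u \_ (@unit_ball R)]
      <= C%:E * sobolev_norm s' fhat)%E) ->
  (amplitude (spacing_constant r) * N) ^+ 2 *
    (2^-1 * (N `^ (1 - 2 / (1 + r)) / 2)) <=
  C ^+ 2 * ((3 * N ^+ 2) `^ s * (2 * pi * N)).
Proof.
move=> r0 r1 N1 s's s0 s2 est.
set c := amplitude _ * N; set h := N `^ _; set B := _ `^ s * _.
have N0 : 0 < N by exact: lt_le_trans N1.
have r10 : 0 < 1 + r by rewrite addr_gt0.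
have h0 : 0 < h by rewrite powR_gt0.
have c0 : 0 <= c by rewrite mulr_ge0 ?(ltW N0) ?(ltW (amplitude_gt0 _)).
have B0 : 0 <= B by rewrite !mulr_ge0 ?powR_ge0 ?pi_ge0 ?(ltW N0).
have K0 : 0 <= spacing_constant r.
  by rewrite mulr_ge0 ?powR_ge0// invr_ge0 ltW.
have h1 : h <= 1.
  rewrite -[leRHS](powRr0 N) ler_powR// subr_le0 ler_pdivlMr// mul1r.
  lra.
have hN : h / N = N `^ (- (2 / (1 + r))).
  rewrite /h powRD; last by rewrite (gt_eqF N0) implybT.
  by rewrite (powRr1 (ltW N0)) mulrAC divff ?mul1r// gt_eqF.
have sobB := sobolev_norm_wave_hat N1 s's s0 s2.
have sob : sobolev s' (wave N) (wave_hat N).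
  split; first exact: L2_fourier_wave.
  exact: le_lt_trans sobB (ltry _).
have := est _ _ (fun n => evolution N (times r n)) sob
  (fun n => propagator_wave (times r n) N0).
(* Since h <= 1, the halved sides keep [E] inside the unit ball. *)
pose E : set (R * R) := `[0, 2^-1] `*` `[- (h / 2), 0[.
have EB : E `<=` @unit_ball R.
  move=> [x1 x2] [] /=; rewrite !in_itv/= => /andP[a1 a2] /andP[b1 b2].
  rewrite /unit_ball /dot /=; nra.
have mE : measurable E by apply: measurableX; exact: measurable_itv.
have uE x : E x -> exists n, c <= Normc.normc (evolution N (times r n) x).
  case: x => x1 x2 [] /=; rewrite !in_itv/= => /andP[a1 a2] /andP[b1 b2].
  (* - x2 / N is the time at which the packet is centred at x2; it is positive because [E] excludes
     x2 = 0. *)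
  have tau0 : 0 < - x2 / N by rewrite divr_gt0// oppr_gt0.
  have tauh : - x2 / N <= h / N by rewrite ler_pM2r ?invr_gt0//; lra.
  rewrite hN in tauh.
  have [n /andP[n1 n2]] := times_dense r0 N1 tau0 tauh.
  exists n.
  have d0 : 0 <= x2 + times r n * N.
    by rewrite -lerBlDl sub0r -ler_pdivrMr.
  have d1 : x2 + times r n * N <= spacing_constant r / N.
    rewrite -lerBrDl -ler_pdivlMr// (le_trans n2)//.
    by rewrite le_eqVlt; apply/orP; left; apply/eqP; field; rewrite gt_eqF.
  have d2 : spacing_constant r / N <= spacing_constant r by rewrite ler_pdivrMr// ler_peMr.
  apply: evolution_ge => //=.
  - by rewrite mulr_ge0 ?times_ge0 ?(ltW N0).
  - lra.
  - rewrite ger0_norm//; lra.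
  - by rewrite ger0_norm.
have L0 : 0 <= c ^+ 2 * (2^-1 * (h / 2)).
  by rewrite mulr_ge0 ?sqr_ge0// mulr_ge0// divr_ge0// ltW.
have low := Lnorm_maximal_ge (fun n => cmeasurable_evolution (times r n) N0) mE EB c0 uE.
move=> /(le_trans low).
rewrite measure_rectangle ?divr_gt0 ?invr_gt0// -EFinM poweR_EFin.
(* With |C| in place of [C] the right side is nonnegative, and both sides can be squared. *)
move=> /le_trans -/(_ (`|C|%:E * (B `^ 2^-1)%:E)%E).
have -> : (C%:E * sobolev_norm s' (wave_hat N) <= `|C|%:E * (B `^ 2^-1)%:E)%E.
  apply: (@le_trans _ _ (`|C|%:E * sobolev_norm s' (wave_hat N))%E).
    by rewrite lee_wpmul2r ?lee_fin ?ler_norm// Lnorm_ge0.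
  by rewrite lee_wpmul2l// lee_fin.
move=> /(_ isT); rewrite -EFinM lee_fin (powR12_sqrt B0) powR12_sqrt//.
move=> /(lerXn2r 2); rewrite !nnegrE => /(_ (sqrtr_ge0 _)).
move=> /(_ (mulr_ge0 (normr_ge0 _) (sqrtr_ge0 _))).
by rewrite (sqr_sqrtr L0) [X in _ <= X -> _]exprMn (sqr_sqrtr B0) real_normK ?num_real.
Qed.

(** If s < r / (r + 1), cancelling common factors in [maximal_estimate_wave] leaves N^d <= D with d
    > 0 and [D] free of [N]; the choice N^d = D + 1 contradicts this. *)
Lemma maximal_estimate_times r s : 0 < r -> r <= 1 ->
  maximal_estimate (times r) s -> r / (r + 1) <= s.
Proof.
move=> r0 r1 [C est]; rewrite leNgt; apply/negP => sr.
have r10 : 0 < r + 1 by rewrite addr_gt0.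
(* A negative [s] is replaced by 0, still below r / (r + 1); r <= 1 then gives sg <= 1/2. *)
pose sg := Num.max s 0.
have ssg : s <= sg by rewrite le_max lexx.
have sg0 : 0 <= sg by rewrite le_max lexx orbT.
have sgr : sg < r / (r + 1) by rewrite gt_max sr divr_gt0.
have sg2 : sg <= 2^-1.
  apply: (le_trans (ltW sgr)); rewrite ler_pdivrMr//; lra.
pose d := 2 * (r / (r + 1) - sg).
have d0 : 0 < d by rewrite mulr_gt0// subr_gt0.
pose a := amplitude (spacing_constant r).
have a0 : 0 < a := amplitude_gt0 _.
pose D := C ^+ 2 * 3 `^ sg * (8 * pi) / a ^+ 2.
have D0 : 0 <= D.
  rewrite /D divr_ge0 ?sqr_ge0// mulr_ge0 ?(mulr_ge0 (sqr_ge0 C) (powR_ge0 _ _))//.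
  by rewrite mulr_ge0 ?pi_ge0.
pose N := (D + 1) `^ d^-1.
have D1 : 1 <= D + 1 by rewrite lerDr.
have N1 : 1 <= N.
  rewrite -[leLHS](powRr0 (D + 1)) ler_powR// invr_ge0 ltW//.
have N0 : 0 < N by exact: lt_le_trans N1.
have Nd : N `^ d = D + 1.
  by rewrite /N -powRrM mulVf ?gt_eqF// powRr1// (le_trans _ D1).
have := maximal_estimate_wave r0 r1 N1 ssg sg0 sg2 est.
rewrite -/a.
have -> : (3 * N ^+ 2) `^ sg = 3 `^ sg * N `^ (2 * sg).
  by rewrite (powRM _ (ler0n _ 3) (sqr_ge0 N)) -(powR_mulrn 2 (ltW N0)) -powRrM.
have -> : N `^ (1 - 2 / (1 + r)) = N `^ d * N `^ (2 * sg) / N.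
  rewrite -(powR_inv1 (ltW N0)) -!powRD ?(gt_eqF N0) ?implybT//.
  by congr (_ `^ _); rewrite /d; field; rewrite gt_eqF.
rewrite Nd; set w := N `^ (2 * sg).
have w0 : 0 < w by rewrite powR_gt0.
have -> : (a * N) ^+ 2 * (2^-1 * ((D + 1) * w / N / 2)) =
  (D + 1) * (a ^+ 2 * N * w / 4) by field; rewrite gt_eqF.
have -> : C ^+ 2 * (3 `^ sg * w * (2 * pi * N)) = D * (a ^+ 2 * N * w / 4).
  by rewrite /D; move: pi => p; field; rewrite gt_eqF.
rewrite ler_pM2r; first by rewrite gerDl ler10.
by rewrite divr_gt0 // (mulr_gt0 (mulr_gt0 (exprn_gt0 2 a0) N0) w0).
Qed.
End counterexample.

Unset Implicit Arguments.
Set Strict Implicit.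
Set Printing Implicit Defensive.

Theorem mainTheorem9 (R : realType) (r : R) (hr0 : 0 < r) (hr1 : r <= 1) :
  exists t : nat -> R,
    [/\ decreasing_seq t,
        t @ \oo --> (0 : R),
        weak_ell r t &
        forall s : R, maximal_estimate t s -> r / (r + 1) <= s].
Proof.
exists (times r); split.
- exact: decreasing_times.
- exact: cvg_times.
- exact: weak_ell_times.
- by move=> s; exact: maximal_estimate_times.
Qed.
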